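(* For an irreducible, positive recurrent Markov chain $\{X_t\}$ with countable state space $\Sigma$ and transition probability matrix $P$, and for any $i\in\Sigma$ and $k\in\mathbb Z_+$, $$\frac{1-\mathbb P_i(T_i>\theta^{(k)})}{\mathbb E_i[\hat T_i^{(k)}]}-\pi_i=\frac{\mathbb P_i(T_i>\theta^{(k)})}{\mathbb E_i[\hat T_i^{(k)}]}\left(\Gamma_i(\theta^{(k)})-1\right),$$ where $$\Gamma_i(\theta)=\sum_{q\in\Sigma\setminus\{i\}}\mathbb P_i\left(X_\theta=q\mid T_i>\theta\right)(Z_{ii}-Z_{qi}).$$
   Context: $\mathbb P_i(\cdot)=\mathbb P(\cdot\mid X_0=i)$ and $\mathbb E_i[\cdot]=\mathbb E[\cdot\mid X_0=i]$; $T_i=\inf\{t\ge1:X_t=i\}$; $\pi$ is the unique stationary distribution; $\mathbb Z_+$ denotes the positive integers and $k$ is an iteration index. $\theta^{(k)}=2^k$ is the truncation threshold at iteration $k$, and $\hat T_i^{(k)}$ is the sample average of independent copies of $\min(T_i,\theta^{(k)})$ (chain started at $i$) collected at iteration $k$, so that $\mathbb E_i[\hat T_i^{(k)}]=\mathbb E_i[\min(T_i,\theta^{(k)})]$. $Z$ is the fundamental matrix, with entries $Z_{jl}=\sum_{t=0}^\infty(P^t_{jl}-\pi_l)$, where $P^t_{jl}$ is the $(j,l)$ entry of $P^t$.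
   Formalization: It is assumed that the series defining Z_{qi} converges for every state q (fixed i); otherwise Z is undefined, e.g. for the periodic two-state flip chain. *)

(* Defs.v *)
From HB Require Import structures.
From mathcomp Require Export all_boot all_order all_algebra.
From mathcomp Require Export all_classical all_reals all_analysis.
Set Implicit Arguments.
Unset Strict Implicit.
Unset Printing Implicit Defensive.
Import Order.TTheory GRing.Theory Num.Theory.
Import numFieldNormedType.Exports.

Local Open Scope classical_set_scope.
Local Open Scope ring_scope.

(* The state space is a [countType]: finite or countably infinite. *)

Section Matrices.
Variables (R : realType) (S : countType).
Implicit Types (P : S -> S -> R) (pi : S -> R).

Definition stochastic P : Prop :=
  (forall j l, 0 <= P j l) /\
  (forall j, \esum_(l in [set: S]) (P j l)%:E = 1%E).

(* The entries are real and, for a stochastic matrix, the sum defining each of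
   them lies in [0, 1], so [fine] loses nothing. *)
Fixpoint matpow P (t : nat) (j l : S) : R :=
  match t with
  | 0 => (j == l)%:R
  | t'.+1 => fine (\esum_(m in [set: S]) (P j m * matpow P t' m l)%:E)
  end.

Definition irreducible P : Prop :=
  forall j l, exists t, 0 < matpow P t j l.

Definition stationary P pi : Prop :=
  [/\ forall j, 0 <= pi j,
      \esum_(j in [set: S]) (pi j)%:E = 1%E &
      forall l, \esum_(j in [set: S]) (pi j * P j l)%:E = (pi l)%:E].

(* Partial sums of the series that defines the entry Z_{jl}. *)
Definition fundamental_series P pi (j l : S) : R^nat :=
  series (fun t => matpow P t j l - pi l).

(* Meaningful only when the series converges: [limn] is total. *)
Definition fundamental_matrix P pi (j l : S) : R :=
  limn (fundamental_series P pi j l).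

(* [\esum] is meant for nonnegative terms; signed terms are summed through
   their positive and negative parts. *)
Definition signed_sum (D : set S) (f : S -> R) : R :=
  fine (\esum_(q in D) ((EFin \o f)^\+ q) -
        \esum_(q in D) ((EFin \o f)^\- q))%E.

End Matrices.

(* Elementary conditional probability; equal to 0 when B is null, because
   division by 0 is 0. *)
Definition cond_prob d (Omega : measurableType d) (R : realType)
    (mu : probability Omega R) (A B : set Omega) : R :=
  fine (mu (A `&` B)) / fine (mu B).

Section Chains.
Variables (R : realType) (S : countType).
Variables (d : measure_display) (Omega : measurableType d).
Implicit Types (P : S -> S -> R) (pi : S -> R).
Implicit Types (Pr : S -> probability Omega R) (X : nat -> Omega -> S).

(* [Pr j] is the law of the chain started at j, that is, the probability given
   X_0 = j. *)
Definition markov_chain Pr X P : Prop :=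
  [/\ forall t l, measurable (X t @^-1` [set l]),
      forall j, Pr j (X 0%N @^-1` [set j]) = 1%E &
      forall j n (x : nat -> S) l,
        let past := [set w | forall t, (t <= n)%N -> X t w = x t] in
        (0 < Pr j past)%E ->
        cond_prob (Pr j) (X n.+1 @^-1` [set l]) past = P (x n) l].

(* T_i; it equals +oo on the trajectories that never come back to i. *)
Definition return_time X (i : S) (w : Omega) : \bar R :=
  ereal_inf [set t%:R%:E | t in [set t : nat | (1 <= t)%N /\ X t w = i]].

Definition positive_recurrent Pr X : Prop :=
  forall j, (\int[Pr j]_w return_time X j w < +oo)%E.

Definition truncated_return_time X (i : S) (theta : nat) (w : Omega) : R :=
  fine (Order.min (return_time X i w) theta%:R%:E).

(* The event {T_i > theta}. *)
Definition late_return X (i : S) (theta : nat) : set Omega :=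
  [set w | (theta%:R%:E < return_time X i w)%E].

Definition Gamma Pr X P pi (i : S) (theta : nat) : R :=
  signed_sum [set q | q != i] (fun q =>
    cond_prob (Pr i) (X theta @^-1` [set q]) (late_return X i theta) *
    (fundamental_matrix P pi i i - fundamental_matrix P pi q i)).

End Chains.

Section Sampling.
Variables (R : realType).
Variables (d d' : measure_display).
Variables (Omega : measurableType d) (Omega' : measurableType d').

(* The tau s are mutually independent, each with the law of f under mu.
   Choosing A s = setT for some indices s gives the product rule for
   subfamilies. *)
Definition independent_copies (mu : probability Omega R) (f : Omega -> R)
    (Q : probability Omega' R) (N : nat) (tau : 'I_N -> {RV Q >-> R}) : Prop :=
  (forall s (A : set R), measurable A ->
     Q (tau s @^-1` A) = mu (f @^-1` A)) /\
  (forall A : 'I_N -> set R, (forall s, measurable (A s)) ->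
     Q (\bigcap_s (tau s @^-1` A s)) = (\prod_s Q (tau s @^-1` A s))%E).

Definition sample_average (Q : probability Omega' R) (N : nat)
    (tau : 'I_N -> {RV Q >-> R}) (w : Omega') : R :=
  (\sum_(s < N) tau s w) / N%:R.

End Sampling.

Arguments late_return R {S d Omega} X i theta.
Arguments truncated_return_time R {S d Omega} X i theta w.

Definition theta (k : nat) : nat := (2 ^ k)%N.

(* Main.v *)
(* Let a_t(q) be the probability that the chain started at q avoids i at the
   times 1, ..., t. Decomposing the first n + 1 steps from q at the last visit
   to i gives
     sum_(s <= n) a_s(q) P^(n-s)(i,i) + sum_(t <= n) P^t(q,i)
       = [q = i] + sum_(t <= n) P^t(i,i).
   Convergence of the series Z_ii forces P^t(i,i) -> pi_i, so when
   E_q T_i = sum_s a_s(q) is finite the limit n -> oo is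
     pi_i E_q T_i = [q = i] + Z_ii - Z_qi.
   For q = i this is pi_i E_i T_i = 1. By the Markov property at time theta,
     E_i T_i = E_i min(T_i, theta)
       + sum_(q != i) P_i(X_theta = q, T_i > theta) E_q T_i,
   and multiplying by pi_i yields 1 = pi_i E_i min(T_i, theta)
   + P_i(T_i > theta) Gamma_i(theta), which is the claim. *)
Require Import Defs.
From mathcomp Require Import zify ring measurable_realfun.
Set Implicit Arguments.
Unset Strict Implicit.
Unset Printing Implicit Defensive.
Import Order.TTheory GRing.Theory Num.Theory.
Import numFieldNormedType.Exports.
Local Open Scope classical_set_scope.
Local Open Scope ring_scope.

(** * Limits of convolutions with a summable sequence *)

(** This passes to the limit in the last-visit identity. After centring [c] at [l], indices [s] far
    from [n] see [c] near its limit, and the other indices lie in a tail of the summable sequence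
    [b]. *)
Lemma cvg_convolution (R : realType) (b c : R^nat) (l : R) :
  (forall n, 0 <= b n) -> cvgn (series b) -> c @ \oo --> l ->
  (fun n => \sum_(s < n.+1) b s * c (n - s)%N) @ \oo --> l * limn (series b).
Proof.
move=> b0 cb cc.
have -> : (fun n => \sum_(s < n.+1) b s * c (n - s)%N) =
   (fun n => \sum_(s < n.+1) b s * (c (n - s)%N - l) + l * series b n.+1).
  apply/funext => n; rewrite /series /= big_mkord mulr_sumr -big_split /=.
  by apply: eq_bigr => s _; rewrite mulrBr [l * _]mulrC subrK.
rewrite -[X in _ --> X]add0r; apply: cvgD; last first.
  apply: cvgMl_tmp; rewrite (cvg_shiftS (series b)); exact: cb.
have e0 : (fun t => `|c t - l|) @ \oo --> 0.
  by apply/norm_cvg0P; rewrite -(subrr l); apply: cvgB => //; exact: cvg_cst.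
have [M M0 eM] : exists2 M, 0 < M & forall t, `|c t - l| <= M.
  have := cvg_seq_bounded (cvgP _ e0).
  move=> /pinfty_ex_gt0 [M M0 HM]; exists M => // t.
  by have := HM t I; rewrite /= normr_id.
have sb_le n : series b n <= limn (series b).
  apply: nondecreasing_cvgn_le => //.
  by apply/nondecreasing_seqP => m; rewrite /series /= big_nat_recr//= lerDl.
set B := limn (series b) in sb_le *.
have B0 : 0 <= B by apply: le_trans (sb_le 0%N); rewrite /series/= big_geq.
apply/cvgr0Pnorm_le => eps eps0.
have BM0 : 0 < B + M by rewrite ltr_wpDl.
(* Chosen so that [d * B + d * M = eps]: the first part of the sum costs [d * B], the second
   [d * M]. *)
pose d := eps / (B + M).
have d0 : 0 < d by rewrite divr_gt0.
have [K _ HK] : \forall t \near \oo, `|c t - l| <= d.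
  by move/cvgr0Pnorm_le : e0 => /(_ _ d0); apply: filterS => t; rewrite normr_id.
have [K' _ HK'] : \forall n \near \oo, `|B - series b n| <= d.
  by move/cvgrPdist_le : cb; apply.
(* The sum is cut at [n.+1 - K]. Below the cut [n - s >= K]; and [n >= K + K'] puts the cut itself
   beyond [K'], so the tail of [b] after it is at most [d]. *)
exists (K + K')%N => // n /= Kn.
apply: le_trans (ler_norm_sum _ _ _) _.
under eq_bigr do rewrite normrM (ger0_norm (b0 _)).
rewrite -(big_mkord xpredT (fun s => b s * `|c (n - s)%N - l|)).
have hKn : (n.+1 - K <= n.+1)%N by rewrite leq_subr.
rewrite (big_cat_nat (leq0n _) hKn) //=.
have -> : eps = d * B + d * M by rewrite -mulrDr divfK// gt_eqF.
apply: lerD.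
  apply: (@le_trans _ _ (d * series b (n.+1 - K)%N)); last first.
    by rewrite ler_wpM2l// ltW.
  rewrite /series /= mulr_sumr !big_nat; apply: ler_sum => s /= hs.
  rewrite mulrC ler_wpM2r//; apply: HK => /=; lia.
apply: (@le_trans _ _ (M * (series b n.+1 - series b (n.+1 - K)%N))).
  rewrite /series /= (big_cat_nat (leq0n _) hKn) //= addrAC subrr add0r mulr_sumr.
  by apply: ler_sum => s _; rewrite mulrC ler_wpM2r.
rewrite mulrC ler_wpM2r ?(ltW M0)//.
have hk : `|B - series b (n.+1 - K)%N| <= d by apply: HK' => /=; lia.
by apply: le_trans (le_trans (ler_norm _) hk); rewrite lerD2r.
Qed.

(** * Nonnegative sums over countable types *)

(** Enumerates the type by its codes, a natural number that encodes nothing contributing 0. Facts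
    about series of extended reals then apply to [\esum]. *)
Lemma esum_pickle_series (R : realType) (T : countType) (a : T -> \bar R) :
  (forall t, 0 <= a t)%E ->
  \esum_(t in [set: T]) a t =
    (\sum_(n <oo) oapp a 0 (@pickle_inv T n))%E.
Proof.
move=> a0; pose b (n : nat) := oapp a 0%E (@pickle_inv T n).
have b0 n : (0 <= b n)%E by rewrite /b; case: pickle_inv => /=.
have -> : \esum_(t in [set: T]) a t =
    \esum_(n in range (@pickle T)) b n.
  rewrite esum_image; last by move=> x y _ _; exact: (pcan_inj (@pickleK T)).
  by apply: eq_esum => t _; rewrite /b pickleK_inv.
rewrite nneseries_esumT// esum_mkcond; apply: eq_esum => n _.
case: ifPn => // /negP nr; rewrite -/(b n) /b.
case E : (@pickle_inv T n) => [t|//]; exfalso; apply: nr.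
rewrite inE; exists t => //.
by have := @pickle_invK T n; rewrite E /=.
Qed.

Lemma ge0_esumZl (R : realType) (T : countType) (a : T -> \bar R) (x : R) :
  (forall t, 0 <= a t)%E -> 0 <= x ->
  (\esum_(t in [set: T]) (x%:E * a t) = x%:E * \esum_(t in [set: T]) a t)%E.
Proof.
move=> a0 x0; rewrite !esum_pickle_series//; last first.
  by move=> t; rewrite mule_ge0.
rewrite -nneseriesZl; last by move=> n _; case: pickle_inv => /=.
apply: eq_eseriesr => n _.
by case: pickle_inv => [t|] //=; rewrite mule0.
Qed.

Lemma esum_exchange (R : realType) (T1 T2 : choiceType)
    (a : T1 -> T2 -> \bar R) :
  (forall i j, 0 <= a i j)%E ->
  \esum_(i in [set: T1]) \esum_(j in [set: T2]) a i j =
  \esum_(j in [set: T2]) \esum_(i in [set: T1]) a i j.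
Proof.
move=> a0; rewrite !esum_esum//.
rewrite (reindex_esum ([set: T2] `*`` fun=> [set: T1]) _
  (fun k : T2 * T1 => (k.2, k.1)))//.
split=> //; first by move=> [x y] [x' y'] _ _ /= [-> ->].
by move=> [x y] _; exists (y, x).
Qed.

(** Countable additivity along the codes of the values of [Y]; codes without a value get the empty
    set. *)
Lemma measure_partition (d : measure_display) (Omega : measurableType d)
    (R : realType) (mu : {measure set Omega -> \bar R}) (T : countType)
    (Y : Omega -> T) (A : set Omega) :
  measurable A -> (forall t, measurable (Y @^-1` [set t])) ->
  mu A = \esum_(t in [set: T]) mu (A `&` Y @^-1` [set t]).
Proof.
move=> mA mY; rewrite esum_pickle_series//.
pose F (n : nat) := oapp (fun t => A `&` Y @^-1` [set t]) set0 (@pickle_inv T n).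
have mF n : measurable (F n).
  by rewrite /F; case: pickle_inv => [t|] //=; exact: measurableI.
have AE : A = \bigcup_n F n.
  apply/seteqP; split=> [w Aw|w [n _]].
    by exists (pickle (Y w)) => //; rewrite /F pickleK_inv.
  by rewrite /F; case: pickle_inv => [t|] //= -[].
have tF : trivIset setT F.
  move=> m n _ _ [w []]; rewrite /F.
  have := @pickle_invK T m; have := @pickle_invK T n.
  case: (@pickle_inv T m) => [t|]//; case: (@pickle_inv T n) => [t'|]//=.
  by move=> <- <- [_ <-] [_ <-].
rewrite {1}AE measure_semi_bigcup//; last exact: bigcupT_measurable.
apply: eq_eseriesr => n _; rewrite /F.
case: pickle_inv => [t|] //=; rewrite measure0.
Qed.

(** * The transition operator, matrix powers and the last-visit identity *)

(** The transition operator, sending [f] to the map from [q] to E_q f(X_1). Extended real values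
    spare finiteness conditions on nonnegative [f]. *)
Definition average (R : realType) (S : countType) (P : S -> S -> R)
    (f : S -> \bar R) (q : S) : \bar R :=
  (\esum_(m in [set: S]) ((P q m)%:E * f m))%E.

(* The probability of not visiting i at the times 1, ..., t from q. *)
Fixpoint survival (R : realType) (S : countType) (P : S -> S -> R) (i : S)
    (t : nat) (q : S) : \bar R :=
  match t with
  | 0 => 1%E
  | t'.+1 => average P (fun m => if m == i then 0%E else survival P i t' m) q
  end.

Section Stochastic.
Context (R : realType) (S : countType) (P : S -> S -> R) (hP : stochastic P).
Implicit Types (f g : S -> \bar R) (q i j l m : S) (n s t : nat).

Lemma stochastic_ge0 q m : 0 <= P q m.
Proof. by case: hP. Qed.
Local Hint Resolve stochastic_ge0 : core.

Lemma average_ge0 f q : (forall m, 0 <= f m)%E -> (0 <= average P f q)%E.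
Proof. by move=> f0; apply: esum_ge0 => m _; rewrite mule_ge0// lee_fin. Qed.

Lemma le_average f g q : (forall m, f m <= g m)%E ->
  (average P f q <= average P g q)%E.
Proof. by move=> fg; apply: le_esum => m _; rewrite lee_wpmul2l// lee_fin. Qed.

Lemma averageD f g q : (forall m, 0 <= f m)%E -> (forall m, 0 <= g m)%E ->
  average P (fun m => f m + g m)%E q = (average P f q + average P g q)%E.
Proof.
move=> f0 g0; rewrite /average -esumD; last 2 first.
- by move=> m _; rewrite mule_ge0// lee_fin.
- by move=> m _; rewrite mule_ge0// lee_fin.
by apply: eq_esum => m _; rewrite ge0_muleDr.
Qed.

Lemma averageZ f q (x : R) : 0 <= x -> (forall m, 0 <= f m)%E ->
  average P (fun m => f m * x%:E)%E q = (average P f q * x%:E)%E.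
Proof.
move=> x0 f0; rewrite /average muleC -ge0_esumZl//; last first.
  by move=> m; rewrite mule_ge0// lee_fin.
by apply: eq_esum => m _; rewrite muleA muleC.
Qed.

Lemma average_cst q (x : R) : 0 <= x -> average P (fun=> x%:E) q = x%:E.
Proof.
move=> x0; transitivity (average P (fun=> 1 * x%:E)%E q).
  by apply: eq_esum => m _; rewrite mul1e.
rewrite averageZ// /average; under eq_esum do rewrite mule1.
by case: hP => _ ->; rewrite mul1e.
Qed.

Lemma average_sum n (f : nat -> S -> \bar R) q :
  (forall s m, 0 <= f s m)%E ->
  average P (fun m => \sum_(s < n) f s m)%E q =
  (\sum_(s < n) average P (f s) q)%E.
Proof.
move=> f0; rewrite /average.
under eq_esum do rewrite ge0_sume_distrr//.
by rewrite esum_sum// => m s _ _; rewrite mule_ge0// lee_fin.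
Qed.

(** By induction: the average of a function with values in [0, 1] stays in [0, 1]. The same bound
    shows that the sum inside [fine] is finite, hence [matpowS]. *)
Lemma matpow_ge0_le1 t j l : 0 <= matpow P t j l <= 1.
Proof.
elim: t j => [j|t IH j] /=; first by case: eqP => _; rewrite ?ler01 ?lexx.
have h0 : (0 <= average P (fun m => (matpow P t m l)%:E) j)%E.
  by apply: average_ge0 => m; rewrite lee_fin; case/andP: (IH m).
have h1 : (average P (fun m => (matpow P t m l)%:E) j <= 1)%E.
  rewrite -[leRHS](average_cst j ler01); apply: le_average => m.
  by rewrite lee_fin; case/andP: (IH m).
have -> : \esum_(m in [set: S]) (P j m * matpow P t m l)%:E =
    average P (fun m => (matpow P t m l)%:E) j by [].
have hf : average P (fun m => (matpow P t m l)%:E) j \is a fin_num.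
  by rewrite ge0_fin_numE// (le_lt_trans h1)// ltry.
by rewrite fine_ge0//= -lee_fin fineK.
Qed.

Lemma matpow_ge0 t j l : 0 <= matpow P t j l.
Proof. by case/andP: (matpow_ge0_le1 t j l). Qed.
Local Hint Resolve matpow_ge0 : core.

Lemma matpowS t j l :
  (matpow P t.+1 j l)%:E = average P (fun m => (matpow P t m l)%:E) j.
Proof.
rewrite /= -[X in fine X]/(average P (fun m => (matpow P t m l)%:E) j) fineK//.
rewrite ge0_fin_numE; last by apply: average_ge0 => m; rewrite lee_fin.
apply: (@le_lt_trans _ _ 1%E); last exact: ltry.
rewrite -[leRHS](average_cst j ler01); apply: le_average => m.
by rewrite lee_fin; case/andP: (matpow_ge0_le1 t m l).
Qed.

Local Arguments matpow : simpl never.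

Lemma survival_ge0 i t q : (0 <= survival P i t q)%E.
Proof.
elim: t q => [//|t IH] q; apply: average_ge0 => m.
by case: eqP => // _; exact: IH.
Qed.
Local Hint Resolve survival_ge0 : core.

Lemma survival_le1 i t q : (survival P i t q <= 1)%E.
Proof.
elim: t q => [//|t IH] q /=; rewrite -[leRHS](average_cst q ler01).
by apply: le_average => m; case: eqP => // _; rewrite lee_fin.
Qed.

Lemma survival_fin_num i t q : survival P i t q \is a fin_num.
Proof. by rewrite ge0_fin_numE// (le_lt_trans (survival_le1 _ _ _))// ltry. Qed.

Lemma survivalS_le i t q : (survival P i t.+1 q <= survival P i t q)%E.
Proof.
elim: t q => [|t IH] q; first exact: survival_le1.
by apply: le_average => m; case: eqP => // _; exact: IH.
Qed.

(* Stated without subtraction, so that all terms are nonnegative extended reals. *)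
Lemma last_visit i n q :
  (\sum_(s < n.+1) survival P i s q * (matpow P (n - s) i i)%:E +
   \sum_(t < n.+1) (matpow P t q i)%:E =
   (q == i)%:R%:E + \sum_(t < n.+1) (matpow P t i i)%:E)%E.
Proof.
elim: n q => [|n IH] q.
  by rewrite !big_ord_recl !big_ord0 !adde0 /= subn0 /matpow /= eqxx mul1e addeC.
(* The term [s = 0] on the left matches the last term on the right, and the term [t = 0] is the
   indicator of [q = i]. What is left must equal [U], and is an average over the first step from
   [q]. *)
rewrite big_ord_recl [X in (_ + X)%E]big_ord_recl [in RHS]big_ord_recr mul1e subn0.
set U := (\sum_(t < n.+1) (matpow P t i i)%:E)%E.
have UE : U = (\sum_(t < n.+1) matpow P t i i)%:E by rewrite -sumEFin.
have U0 : 0 <= \sum_(t < n.+1) matpow P t i i by apply: sumr_ge0.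
suff <- : (\sum_(s < n.+1) survival P i s.+1 q * (matpow P (n - s) i i)%:E +
    \sum_(t < n.+1) (matpow P t.+1 q i)%:E = U)%E.
  have shuffle (u v w x : \bar R) : (u + v + (w + x) = w + (v + x + u))%E.
    by rewrite addeACA (addeC u) -addeA (addeC u).
  exact: shuffle.
have -> : (\sum_(t < n.+1) (matpow P t.+1 q i)%:E)%E =
    average P (fun m => \sum_(t < n.+1) (matpow P t m i)%:E)%E q.
  rewrite (@average_sum n.+1 (fun t m => (matpow P t m i)%:E)).
    by apply: eq_bigr => t _; exact: matpowS.
  by move=> *; rewrite lee_fin.
pose g s m := ((if m == i then 0 else survival P i s m) *
  (matpow P (n - s) i i)%:E)%E.
have g0 s m : (0 <= g s m)%E.
  by rewrite mule_ge0 ?lee_fin//; case: eqP.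
have -> : (\sum_(s < n.+1) survival P i s.+1 q * (matpow P (n - s) i i)%:E)%E =
    average P (fun m => \sum_(s < n.+1) g s m)%E q.
  rewrite average_sum//; apply: eq_bigr => s _.
  by rewrite averageZ// => m; case: eqP.
rewrite -averageD; last 2 first.
- by move=> m; apply: sume_ge0.
- by move=> m; apply: sume_ge0 => t _; rewrite lee_fin.
rewrite UE -[RHS](average_cst q U0); apply: eq_esum => m _; congr (_ * _)%E.
(* For [m = i] the survival terms vanish and the other sum is [U] itself; for [m <> i] this is the
   induction hypothesis with a zero indicator. *)
rewrite -UE /g; have := IH m; case: eqP => [-> _|_]; last by rewrite add0e.
by rewrite big1 ?add0e// => s _; rewrite mul0e.
Qed.

End Stochastic.

(* For q = i this is Kac's formula. *)
Lemma stationary_expected_return (R : realType) (S : countType)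
    (P : S -> S -> R) (pi : S -> R) (i q : S) :
  stochastic P ->
  cvgn (fundamental_series P pi i i) -> cvgn (fundamental_series P pi q i) ->
  (\sum_(s <oo) survival P i s q < +oo)%E ->
  ((pi i)%:E * \sum_(s <oo) survival P i s q)%E =
  ((q == i)%:R + (fundamental_matrix P pi i i - fundamental_matrix P pi q i))%:E.
Proof.
move=> hP cii cqi tot_lty.
pose b s := fine (survival P i s q).
have b0 s : 0 <= b s by rewrite fine_ge0 ?survival_ge0.
have bE s : survival P i s q = (b s)%:E by rewrite fineK ?survival_fin_num.
have summ : summable (xpredT : pred nat) (fun s => survival P i s q).
  apply: le_lt_trans tot_lty; rewrite nneseries_esum; last first.
    by move=> s _; exact: survival_ge0.
  by apply: le_esum => s _; rewrite gee0_abs// survival_ge0.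
have cb : cvgn (series b).
  exact: (summable_cvg (P := xpredT) (fun s _ => survival_ge0 hP i s q) summ).
have -> : (\sum_(s <oo) survival P i s q)%E = (limn (series b))%:E.
  exact: (summable_nneseries_lim (P := xpredT) (fun s _ => survival_ge0 hP i s q) summ).
have cP : (fun t => matpow P t i i) @ \oo --> pi i.
  by apply/subr_cvg0; exact: cvg_series_cvg_0 cii.
rewrite -EFinM; congr EFin.
have h1 := cvg_convolution b0 cb cP.
(* The same convolution, evaluated by [last_visit]. Both fundamental series subtract [pi i] at each
   time, so these constants cancel in the difference of partial sums. *)
have h2 : (fun n => \sum_(s < n.+1) b s * matpow P (n - s)%N i i) @ \oo -->
  (q == i)%:R + (fundamental_matrix P pi i i - fundamental_matrix P pi q i).
  have -> : (fun n => \sum_(s < n.+1) b s * matpow P (n - s)%N i i) =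
     (fun n => (q == i)%:R + (fundamental_series P pi i i n.+1 -
       fundamental_series P pi q i n.+1)).
    apply/funext => n; have := last_visit hP i n q.
    under eq_bigr do rewrite bE -EFinM.
    rewrite !sumEFin -!EFinD => -[E].
    rewrite /fundamental_series /series /= !sumrB opprB [X in _ = _ + X]addrA subrK !big_mkord.
    by rewrite addrA -E addrK.
  apply: cvgD; first exact: cvg_cst.
  by apply: cvgB; rewrite cvg_shiftS.
exact: (cvg_unique _ h1 h2).
Qed.

(** * Avoidance events and the Markov property *)

(** Trades an infimum over all times for a condition on the times 1 to [n], from which measurability
    and dependence on the past alone can be read off. *)
Lemma late_returnE (R : realType) (S : countType) (d : measure_display)
    (Omega : measurableType d) (X : nat -> Omega -> S) (i : S) (n : nat) :
  late_return R X i n = [set w | forall t, (1 <= t <= n)%N -> X t w <> i].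
Proof.
apply/seteqP; split=> w /=; rewrite /late_return /return_time /=.
  move=> late t /andP[t1 tn] Xt.
  have : (n%:R%:E < t%:R%:E :> \bar R)%E.
    by apply: lt_le_trans late _; apply: ereal_inf_lbound; exists t.
  by rewrite lte_fin ltr_nat ltnNge tn.
(* Return times are integers, so avoiding [i] up to [n] bounds them below by [n.+1], strictly above
   [n]. *)
move=> avoid; apply: (@lt_le_trans _ _ n.+1%:R%:E); first by rewrite lte_fin ltr_nat.
apply: le_ereal_inf_tmp => _ [t [t1 Xt] <-]; rewrite lee_fin ler_nat ltnNge.
by apply/negP => tn; apply: (avoid t) => //; rewrite t1.
Qed.

Section Chain.
Context (R : realType) (S : countType) (d : measure_display)
  (Omega : measurableType d) (Pr : S -> probability Omega R)
  (X : nat -> Omega -> S) (P : S -> S -> R).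
Hypotheses (hP : stochastic P) (hX : markov_chain Pr X P).
Implicit Types (i j l m : S) (n s t : nat).

Lemma measurable_state t l : measurable (X t @^-1` [set l]).
Proof. by case: hX. Qed.
Local Hint Resolve measurable_state : core.

Lemma measurable_past n (x : nat -> S) :
  measurable [set w | forall t, (t <= n)%N -> X t w = x t].
Proof.
rewrite [X in measurable X](_ : _ =
    \bigcap_(t in [set t | (t <= n)%N]) (X t @^-1` [set x t])).
  exact: bigcap_measurableType.
by apply/seteqP; split=> w /= h t; exact: h.
Qed.

Lemma measurable_late_return i n : measurable (late_return R X i n).
Proof.
rewrite late_returnE [X in measurable X](_ : _ =
    \bigcap_(t in [set t | (1 <= t <= n)%N]) ~` (X t @^-1` [set i])).
  by apply: bigcap_measurableType => t _; exact: measurableC.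
by apply/seteqP; split=> w /= h t; exact: h.
Qed.
Local Hint Resolve measurable_late_return : core.

(** [markov_chain] conditions on complete pasts of positive probability only. An event [A]
    determined by the past up to [n] is a countable disjoint union of complete pasts, and the null
    ones contribute 0 to both sides. *)
Lemma markov_event j n (A : set Omega) m l :
  measurable A -> A `<=` X n @^-1` [set m] ->
  (forall w w', (forall t, (t <= n)%N -> X t w = X t w') -> A w -> A w') ->
  (Pr j (A `&` X n.+1 @^-1` [set l]) = Pr j A * (P m l)%:E)%E.
Proof.
move=> mA Am Apast.
(* The past is coded as a finite sequence of states, which takes only countably many values. *)
pose Y w := mkseq (X ^~ w) n.+1.
have YE w w' : Y w = Y w' <-> forall t, (t <= n)%N -> X t w = X t w'.
  split=> [Yw t tn|Xw].
    have := congr1 (fun r => nth (X 0%N w) r t) Yw.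
    by rewrite /Y !nth_mkseq.
  by apply/eq_in_map => t; rewrite mem_iota => /andP[_ tn]; exact: Xw.
have YpastE w : Y @^-1` [set Y w] =
    [set w' | forall t, (t <= n)%N -> X t w' = X t w].
  by apply/seteqP; split=> w' /=; rewrite YE.
have mY (r : seq S) : measurable (Y @^-1` [set r]).
  have [[w wr]|nw] := pselect (exists w, Y w = r).
    by rewrite -wr YpastE; exact: measurable_past.
  rewrite [X in measurable X](_ : _ = set0)//; apply/seteqP; split=> w //= wr.
  by apply: nw; exists w.
rewrite (measure_partition (Pr j) (measurableI _ _ mA (measurable_state _ _)) mY).
rewrite muleC (measure_partition (Pr j) mA mY).
rewrite -ge0_esumZl// ?stochastic_ge0//; apply: eq_esum => r _.
rewrite setIAC muleC; set C := (X in _ = (Pr j X * _)%E).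
rewrite -[X in Pr j X = _]/(C `&` _).
have mC : measurable C by exact: measurableI (mY r).
have [B0|B_neq0] := eqVneq (Pr j C) 0%E.
  rewrite B0 mul0e; apply/eqP; rewrite eq_le measure_ge0 andbT -B0.
  by apply: le_measure; rewrite ?inE//; exact: measurableI.
(* A non-null piece contains some trajectory [w]; as [A] depends on the past alone, the piece is the
   whole past of [w]. *)
have [w [Aw Yw]] : C !=set0.
  by apply/set0P; apply: contra_neq B_neq0 => ->; rewrite measure0.
have pastE : C =
    [set w' | forall t, (t <= n)%N -> X t w' = X t w].
  rewrite /C -Yw YpastE; apply/seteqP; split=> w' /= => [[]//|Xw'].
  by split=> //; apply: Apast Aw => t /Xw' ->.
rewrite pastE in B_neq0 *; set past := [set w' | _] in B_neq0 *.
have mpast : measurable past by exact: measurable_past.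
have past_gt0 : (0 < Pr j past)%E by rewrite lt_neqAle eq_sym B_neq0 measure_ge0.
have fpast := fin_num_measure (Pr j) _ mpast.
have fXpast := fin_num_measure (Pr j) _ (measurableI _ _ (measurable_state n.+1 l) mpast).
case: hX => _ _ /(_ j n (X ^~ w) l past_gt0); rewrite (Am _ Aw) => <-.
rewrite /cond_prob setIC -[in LHS](fineK fXpast) -[X in (X * _)%E](fineK fpast).
by rewrite -EFinM mulrC divfK// fine_eq0.
Qed.

(** Last-step recursion for the taboo probabilities of the chain avoiding [i]. If [l <> i],
    avoidance at time [n.+1] follows from [X n.+1 = l], so only avoidance up to [n] remains and
    [markov_event] applies. *)
Lemma late_return_step i j n l :
  Pr j (late_return R X i n.+1 `&` X n.+1 @^-1` [set l]) =
  (if l == i then 0%E else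
  \esum_(m in [set: S]) ((P m l)%:E * Pr j (late_return R X i n `&` X n @^-1` [set m])))%E.
Proof.
case: eqP => [->|li].
  rewrite [X in Pr j X](_ : _ = set0) ?measure0//; apply/seteqP; split=> w //=.
  by rewrite late_returnE => -[/(_ n.+1)]; rewrite ltnSn /=; apply.
have -> : late_return R X i n.+1 `&` X n.+1 @^-1` [set l] =
    late_return R X i n `&` X n.+1 @^-1` [set l].
  rewrite !late_returnE; apply/seteqP; split=> w /= [avoid Xl]; split=> //.
    by move=> t /andP[t1 tn]; apply: avoid; rewrite t1 ltnW.
  move=> t /andP[t1]; rewrite leq_eqVlt => /orP[/eqP->|tn]; first by rewrite Xl.
  by apply: avoid; rewrite t1.
rewrite (measure_partition (Pr j) (measurableI _ _ _ _) (measurable_state n))//.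
apply: eq_esum => m _; rewrite setIAC muleC; apply: markov_event.
- exact: measurableI.
- by move=> w [].
- move=> w w' ww' []; rewrite late_returnE /= => avoid Xm.
  split; last by rewrite -ww'.
  by move=> t /andP[t1 tn]; rewrite -ww'//; apply: avoid; rewrite t1.
Qed.

(** The Markov property at time [n] on the event T_i > n. The induction on [n] keeps [s] free: the
    step into time [n.+1] becomes the first step of the later survival, turning the pair [n.+1], [s]
    into [n], [s.+1]. *)
Lemma survival_shift i j n s :
  (\esum_(l in [set: S]) (Pr j (late_return R X i n `&` X n @^-1` [set l]) *
    survival P i s l))%E = survival P i (n + s) j.
Proof.
elim: n s => [|n IH] s.
  have X0 : Pr j (X 0%N @^-1` [set j]) = 1%E by case: hX.
  rewrite (esumID [set j]); last first.
    by move=> l _; rewrite mule_ge0// survival_ge0.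
  have late0 : late_return R X i 0 = setT.
    by rewrite late_returnE; apply/seteqP; split=> // w _ t; case: t.
  rewrite !setTI late0 esum_set1; last by rewrite mule_ge0// survival_ge0.
  (* The chain starts at [j] almost surely, so for [l <> j] the event [X 0 = l] is null. *)
  rewrite setTI X0 mul1e esum1 ?adde0// => l /= lj.
  rewrite setTI [X in (X * _)%E](_ : _ = 0%E) ?mul0e//.
  apply/eqP; rewrite eq_le measure_ge0 andbT.
  rewrite -(subee (x := 1%E))// -{2}X0 -probability_setC//.
  by apply: le_measure; rewrite ?inE; [|exact: measurableC|move=> w /= ->].
transitivity (\esum_(l in [set: S]) \esum_(m in [set: S])
    (Pr j (late_return R X i n `&` X n @^-1` [set m]) *
     ((P m l)%:E * (if l == i then 0 else survival P i s l))))%E.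
  apply: eq_esum => l _; rewrite late_return_step; case: eqP => _.
    by rewrite mul0e; under eq_esum do rewrite !mule0; rewrite esum1.
  rewrite muleC -[survival P i s l]fineK ?survival_fin_num//.
  rewrite -ge0_esumZl; last 2 first.
  - by move=> m; rewrite mule_ge0// lee_fin stochastic_ge0.
  - by rewrite fine_ge0 ?survival_ge0.
  apply: eq_esum => m _; rewrite muleA muleC; congr (_ * _)%E.
  by rewrite muleC.
have ge0 m l : (0 <= (P m l)%:E * (if l == i then 0 else survival P i s l))%E.
  by rewrite mule_ge0 ?lee_fin ?stochastic_ge0//; case: eqP => // _; exact: survival_ge0.
rewrite esum_exchange; last by move=> *; rewrite mule_ge0.
rewrite addSnnS -IH; apply: eq_esum => m _ /=.
have fX := fin_num_measure (Pr j) _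
  (measurableI _ _ (measurable_late_return i n) (measurable_state n m)).
by rewrite -[Pr j _]fineK// ge0_esumZl// fine_ge0.
Qed.

(** The case [s = 0] of [survival_shift]: it gives the recursively defined [survival] its
    probabilistic meaning. *)
Lemma late_return_prob i j n : Pr j (late_return R X i n) = survival P i n j.
Proof.
rewrite (measure_partition (Pr j) (measurable_late_return i n) (measurable_state n)).
by rewrite -[n in RHS]addn0 -survival_shift; apply: eq_esum => l _; rewrite mule1.
Qed.

End Chain.

(** * The return time as a sum of tail indicators *)

Section ReturnTime.
Context (R : realType) (S : countType) (d : measure_display)
  (Omega : measurableType d) (X : nat -> Omega -> S) (i : S).

Lemma return_time_nat w : return_time R X i w = +oo%E :> \bar R \/
  exists tau : nat, return_time R X i w = tau%:R%:E :> \bar R.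
Proof.
have [ret|noret] := pselect (exists t, (1 <= t)%N && (X t w == i)); last first.
  left; rewrite /return_time [X in ereal_inf X](_ : _ = set0) ?ereal_inf0//.
  apply/seteqP; split=> x //= [t [t1 Xt] _]; apply: noret; exists t.
  by rewrite t1 Xt eqxx.
right; case: (ex_minnP ret) => tau /andP[tau1 /eqP Xtau] tau_min.
exists tau; apply/eqP; rewrite eq_le; apply/andP; split.
  by apply: ereal_inf_lbound; exists tau.
apply: le_ereal_inf_tmp => _ [t [t1 Xt] <-]; rewrite lee_fin ler_nat.
by apply: tau_min; rewrite t1 Xt eqxx.
Qed.

Lemma indic_late_return t w :
  \1_(late_return R X i t) w = (t%:R%:E < return_time R X i w)%E%:R :> R.
Proof. by rewrite indicE; congr (_%:R); congr nat_of_bool; apply/idP/idP; rewrite inE. Qed.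

(** Layer-cake counting: exactly min(T_i, n) of the times [t < n] satisfy t < T_i. *)
Lemma sum_indic_late_return n w :
  (\sum_(t < n) \1_(late_return R X i t) w)%:E =
  Order.min (return_time R X i w) (n%:R%:E : \bar R).
Proof.
under eq_bigr do rewrite indic_late_return.
have [-> | [tau ->]] := return_time_nat w.
  rewrite minEle leye_eq; under eq_bigr do rewrite ltry.
  by rewrite sumr_const card_ord.
under eq_bigr do rewrite lte_fin ltr_nat.
rewrite -natr_sum -EFin_min -natr_min; congr (_%:R%:E).
by elim: n => [|n IH]; rewrite ?big_ord0 ?big_ord_recr/= ?IH; lia.
Qed.

Lemma truncated_return_timeE n :
  truncated_return_time R X i n =
  (fun w => \sum_(t < n) \1_(late_return R X i t) w).
Proof.
by apply/funext => w; rewrite /truncated_return_time -sum_indic_late_return.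
Qed.

(** The partial sums are min(T_i, n): eventually constant when T_i is finite, equal to [n]
    otherwise. *)
Lemma return_time_series w :
  return_time R X i w = (\sum_(t <oo) (\1_(late_return R X i t) w)%:E)%E.
Proof.
apply/esym/cvg_lim => //.
rewrite (_ : (fun n => _) =
    (fun n => Order.min (return_time R X i w) (n%:R%:E : \bar R))); last first.
  by apply/funext => n; rewrite -sum_indic_late_return big_mkord sumEFin.
have [-> | [tau ->]] := return_time_nat w.
  rewrite (_ : (fun n => _) = (fun n => (n%:R%:E : \bar R))).
    exact/cvgeryP/cvgr_idn.
  by apply/funext => n; rewrite minEle leye_eq.
apply: cvg_near_cst; exists tau => // n /= taun.
by apply/min_idPl; rewrite lee_fin ler_nat.
Qed.

End ReturnTime.

(** * Expectations of return times and of sample averages *)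

Section Expectation.
Context (R : realType) (S : countType) (d : measure_display)
  (Omega : measurableType d) (Pr : S -> probability Omega R)
  (X : nat -> Omega -> S) (P : S -> S -> R).
Hypotheses (hP : stochastic P) (hX : markov_chain Pr X P).
Implicit Types (i j : S) (n t : nat).

(** Tail-sum formula, by termwise integration of a nonnegative series. Positive recurrence thus
    becomes summability of [survival]. *)
Lemma integral_return_time i j :
  (\int[Pr j]_w return_time R X i w = \sum_(t <oo) survival P i t j)%E.
Proof.
under eq_integral do rewrite return_time_series.
have mlate t := measurable_late_return hX i t.
rewrite integral_nneseries//; last first.
  by move=> t; exact/measurable_EFinP/measurable_indic.
apply: eq_eseriesr => t _; by rewrite integral_indic// setIT; exact: (late_return_prob hP hX).
Qed.

Lemma measurable_truncated_return_time i n :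
  measurable_fun setT (truncated_return_time R X i n).
Proof.
rewrite truncated_return_timeE; apply: measurable_sum => t.
by apply: measurable_indic; exact: (measurable_late_return hX).
Qed.

Lemma truncated_return_time_ge0 i n w : 0 <= truncated_return_time R X i n w.
Proof. by rewrite truncated_return_timeE sumr_ge0. Qed.

Lemma integral_truncated_return_time i j n :
  (\int[Pr j]_w (truncated_return_time R X i n w)%:E =
   \sum_(t < n) survival P i t j)%E.
Proof.
rewrite truncated_return_timeE.
under eq_integral do rewrite -sumEFin.
have mlate t := measurable_late_return hX i t.
rewrite ge0_integral_sum//; last first.
  by move=> t; exact/measurable_EFinP/measurable_indic.
by apply: eq_bigr => t _; rewrite integral_indic// setIT; exact: (late_return_prob hP hX).
Qed.

End Expectation.

(** A common law means a common pushforward measure, so every [tau s] has the integral of [f];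
    linearity then averages [N] equal numbers. *)
Lemma expectation_sample_average (R : realType) (d d' : measure_display)
    (Omega : measurableType d) (Omega' : measurableType d')
    (mu : probability Omega R) (f : Omega -> R) (Q : probability Omega' R)
    (N : nat) (tau : 'I_N -> {RV Q >-> R}) :
  (0 < N)%N -> measurable_fun setT f -> (forall w, 0 <= f w) ->
  (\int[mu]_w (f w)%:E < +oo)%E ->
  (forall s (A : set R), measurable A -> Q (tau s @^-1` A) = mu (f @^-1` A)) ->
  ('E_Q[sample_average tau])%E = (\int[mu]_w (f w)%:E)%E.
Proof.
move=> N0 mf f0 f_lty law.
have int_f : mu.-integrable setT (EFin \o f).
  apply/integrableP; split; first exact/measurable_EFinP.
  by under eq_integral do rewrite /= ger0_norm//.
have law_integral (g : R -> \bar R) s :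
    (\int[pushforward Q (tau s)]_x g x = \int[pushforward mu f]_x g x)%E.
  by apply: eq_measure_integral => A mA _; exact: law.
(* Integrability passes through the law as well, applied to absolute values; linearity relies on
   it. *)
have itau s : Q.-integrable setT (EFin \o tau s).
  apply/integrableP; split; first exact/measurable_EFinP.
  have := law_integral (fun x => `|x|%:E) s.
  have mnorm : measurable_fun setT (fun x : R => `|x|%:E).
    by apply/measurable_EFinP; exact: normr_measurable.
  rewrite !ge0_integral_pushforward//.
  move=> /= ->; by under eq_integral do rewrite /= ger0_norm//.
have Etau s : (\int[Q]_w (tau s w)%:E = \int[mu]_w (f w)%:E)%E.
  have := law_integral EFin s.
  by rewrite !integral_pushforward.
rewrite unlock /sample_average.
under eq_integral do rewrite mulrC EFinM -sumEFin.
rewrite integralZl//; last first.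
  by apply: (integrable_sum measurableT) => s _; exact: itau.
rewrite integral_sum// (eq_bigr _ (fun s _ => Etau s)).
rewrite -(fineK (integrable_fin_num measurableT int_f)) sumEFin -EFinM.
by rewrite sumr_const card_ord -[X in _ * X]mulr_natl mulKf// pnatr_eq0 -lt0n.
Qed.

(** * The expected return time beyond the threshold *)

Lemma ge0_signed_sum (R : realType) (S : countType) (D : set S) (f : S -> R) :
  (forall q, D q -> 0 <= f q) ->
  signed_sum D f = fine (\esum_(q in D) (f q)%:E).
Proof.
move=> f0; rewrite /signed_sum [X in (_ - X)%E]esum1; last first.
  by move=> q Dq; rewrite funenegE; apply/max_idPr; rewrite leeNl oppe0 lee_fin f0.
rewrite sube0; congr fine; apply: eq_esum => q Dq.
by rewrite funeposE; apply/max_idPl; rewrite lee_fin f0.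
Qed.

Section Residual.
Context (R : realType) (S : countType) (d : measure_display)
  (Omega : measurableType d) (Pr : S -> probability Omega R)
  (X : nat -> Omega -> S) (P : S -> S -> R) (pi : S -> R).
Hypotheses (hP : stochastic P) (hX : markov_chain Pr X P)
  (hpi : forall j, 0 <= pi j).
Context (i : S) (n : nat).
Hypotheses (hZ : forall q, cvgn (fundamental_series P pi q i))
  (n_gt0 : (0 < n)%N) (hret : (\sum_(s <oo) survival P i s i < +oo)%E).

Let W q := Pr i (late_return R X i n `&` X n @^-1` [set q]).

Let measurable_W q : measurable (late_return R X i n `&` X n @^-1` [set q]).
Proof.
apply: measurableI; first exact: (measurable_late_return hX).
exact: (measurable_state hX).
Qed.

Let W_fin q : W q \is a fin_num.
Proof. exact: fin_num_measure. Qed.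

(** Both sides are the mean of the positive part of T_i - n; the right side restarts the chain at
    time [n] from its state [q]. *)
Lemma survival_tail :
  (\sum_(s <oo) survival P i (n + s) i =
   \esum_(q in [set: S]) W q * \sum_(s <oo) survival P i s q)%E.
Proof.
have surv0 s q : (0 <= survival P i s q)%E by exact: survival_ge0.
rewrite nneseries_esumT//.
under eq_esum do rewrite -(survival_shift hP hX).
rewrite esum_exchange; last by move=> s q; rewrite mule_ge0.
apply: eq_esum => q _; rewrite nneseries_esumT// -/(W q) -(fineK (W_fin q)).
by rewrite ge0_esumZl// fine_ge0.
Qed.

Lemma survival_tail_le :
  (\sum_(s <oo) survival P i (n + s) i <= \sum_(s <oo) survival P i s i)%E.
Proof.
apply: lee_nneseries => [s _ _|s _]; first exact: survival_ge0.
elim: n => [//|m IH]; rewrite addSn; exact: le_trans (survivalS_le hP _ _ _) IH.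
Qed.

(** An infinite mean return time from a state of positive weight would make the sum in
    [survival_tail] infinite, against [hret]. *)
Lemma expected_return_lty q : W q != 0%E -> (\sum_(s <oo) survival P i s q < +oo)%E.
Proof.
move=> Wq; rewrite ltey; apply/eqP => toty.
have : (\sum_(s <oo) survival P i (n + s) i < +oo)%E.
  exact: le_lt_trans survival_tail_le hret.
rewrite survival_tail ltNge => /negP; apply.
apply: esum_ge; exists [set q]; first by split.
by rewrite fsbig_set1 toty gt0_muley// lt_neqAle eq_sym Wq measure_ge0.
Qed.

Lemma residual_term q : q != i ->
  (W q * ((pi i)%:E * \sum_(s <oo) survival P i s q))%E =
  (fine (W q) *
    (fundamental_matrix P pi i i - fundamental_matrix P pi q i))%:E.
Proof.
(* For [W q = 0] the mean return time from [q] may be infinite; the product is still 0 since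
   [0 * +oo = 0]. *)
move=> qi; have [W0|W0] := eqVneq (W q) 0%E; first by rewrite W0 /= !mul0e mul0r.
rewrite stationary_expected_return//; last exact: expected_return_lty.
by rewrite (negbTE qi) add0r EFinM fineK.
Qed.

(** By [residual_term], the terms of [Gamma] are those of [survival_tail] multiplied by [pi i] and
    divided by the probability of late return. Hence they are nonnegative and [Gamma] is an ordinary
    sum. *)
Lemma late_Gamma :
  fine (Pr i (late_return R X i n)) * Gamma Pr X P pi i n =
  pi i * fine (\sum_(s <oo) survival P i (n + s) i)%E.
Proof.
set p := fine _; set tail := (\sum_(s <oo) _)%E.
have surv0 s q : (0 <= survival P i s q)%E by exact: survival_ge0.
have tot0 q : (0 <= \sum_(s <oo) survival P i s q)%E by apply: nneseries_ge0.
have pE : p = fine (survival P i n i) by rewrite /p (late_return_prob hP hX).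
have p0 : 0 <= p by rewrite pE fine_ge0.
(* Here [n > 0] matters: T_i > n excludes X_n = i, so the state [i] left out of [Gamma] carries no
   weight. *)
have Wi : W i = 0%E.
  rewrite /W -[n]prednK// (late_return_step hP hX) eqxx//.
(* If late return is null, the left side is 0 whatever [Gamma] is, and [survival], nonincreasing in
   time, vanishes from [n] on. *)
have [p_eq0|p_neq0] := eqVneq p 0.
  rewrite p_eq0 mul0r [tail]eseries0 ?mulr0// => s _ _.
  apply/eqP; rewrite eq_le surv0 andbT.
  have <- : survival P i n i = 0%E.
    by rewrite -(fineK (survival_fin_num hP i n i)) -pE p_eq0.
  elim: s => [|s IH]; first by rewrite addn0.
  by rewrite addnS; apply: le_trans (survivalS_le hP _ _ _) IH.
have Gterm q : q != i ->
    (cond_prob (Pr i) (X n @^-1` [set q]) (late_return R X i n) *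
      (fundamental_matrix P pi i i - fundamental_matrix P pi q i))%:E =
    (p^-1%:E * (W q * ((pi i)%:E * \sum_(s <oo) survival P i s q)))%E.
  move=> qi; rewrite residual_term// -EFinM; congr EFin.
  by rewrite /cond_prob setIC mulrA [p^-1 * _]mulrC.
have term0 q : (0 <= W q * ((pi i)%:E * \sum_(s <oo) survival P i s q))%E.
  by rewrite mule_ge0 ?mule_ge0 ?lee_fin.
rewrite /Gamma ge0_signed_sum; last first.
  by move=> q /= qi; rewrite -lee_fin Gterm// mule_ge0// lee_fin invr_ge0.
rewrite (eq_esum Gterm) esum_mkcond.
rewrite (_ : \esum_(q in _) _ = ((p^-1)%:E * ((pi i)%:E * tail))%E); last first.
  rewrite /tail survival_tail -ge0_esumZl//; last by move=> q; rewrite mule_ge0.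
  rewrite -ge0_esumZl ?invr_ge0//; last by move=> q; rewrite !mule_ge0 ?lee_fin.
  apply: eq_esum => q _; case: ifPn => [_|]; first by rewrite (muleCA (pi i)%:E).
  by rewrite notin_setE /= => /negP; rewrite negbK => /eqP ->; rewrite Wi !mul0e !mule0.
have ftail : tail \is a fin_num.
  rewrite ge0_fin_numE; last by apply: nneseries_ge0.
  exact: le_lt_trans survival_tail_le hret.
by rewrite -(fineK ftail) -!EFinM /= mulVKf.
Qed.

End Residual.

Theorem lemma11 (R : realType) (S : countType)
    (d : measure_display) (Omega : measurableType d)
    (Pr : S -> probability Omega R) (X : nat -> Omega -> S)
    (P : S -> S -> R) (pi : S -> R)
    (hP : stochastic P) (hX : markov_chain Pr X P)
    (hirr : irreducible P) (hrec : positive_recurrent Pr X)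
    (hpi : stationary P pi)
    (i : S)
    (hZ : forall q : S, cvgn (fundamental_series P pi q i))
    (k : nat) (hk : (0 < k)%N)
    (d' : measure_display) (Omega' : measurableType d')
    (Q : probability Omega' R)
    (N : nat) (hN : (0 < N)%N) (tau : 'I_N -> {RV Q >-> R})
    (htau : independent_copies (Pr i)
              (truncated_return_time R X i (theta k)) tau) :
  let p := fine (Pr i (late_return R X i (theta k))) in
  let ET := fine ('E_Q[sample_average tau])%E in
  (1 - p) / ET - pi i = p / ET * (Gamma Pr X P pi i (theta k) - 1).
Proof.
move=> p ET; set n := theta k.
have n_gt0 : (0 < n)%N by rewrite expn_gt0.
have surv0 s q : (0 <= survival P i s q)%E by exact: survival_ge0.
have hret : (\sum_(s <oo) survival P i s i < +oo)%E.
  by rewrite -(integral_return_time hP hX); exact: hrec.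
have pi0 j : 0 <= pi j by case: hpi.
have sum_lty : (\sum_(t < n) survival P i t i < +oo)%E.
  by apply: lte_sum_pinfty => t _; rewrite ltey_eq survival_fin_num.
have meanE := integral_truncated_return_time hP hX i i n.
have ETE : ET%:E = (\sum_(t < n) survival P i t i)%E.
  rewrite /ET (expectation_sample_average hN _ _ _ htau.1).
  - by rewrite meanE fineK// ge0_fin_numE// sume_ge0.
  - exact: (measurable_truncated_return_time hX).
  - exact: truncated_return_time_ge0.
  - by rewrite meanE.
have ET_gt0 : 0 < ET.
  (* The term [t = 0], present because [n > 0], is already 1. *)
  rewrite -lte_fin ETE -(prednK n_gt0) big_ord_recl /=.
  apply: (@lt_le_trans _ _ 1%E); first exact: lte01.
  by rewrite leeDl// sume_ge0// => t _; exact: (surv0 t.+1 i).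
(* Kac's formula with its series split at [n]: the first [n] terms sum to [ET], and [late_Gamma]
   evaluates the rest. *)
have total : 1 = pi i * ET + p * Gamma Pr X P pi i n.
  have := stationary_expected_return hP (hZ i) (hZ i) hret.
  rewrite eqxx subrr addr0 (nneseries_split 0 n)//.
  rewrite add0n -nneseries_addn// big_mkord -ETE.
  under eq_eseriesr do rewrite addnC.
  rewrite (late_Gamma hP hX pi0 hZ n_gt0 hret) -mulrDr.
  have ftail : (\sum_(s <oo) survival P i (n + s) i)%E \is a fin_num.
    rewrite ge0_fin_numE; last exact: nneseries_ge0.
    exact: le_lt_trans (survival_tail_le hP i n) hret.
  by rewrite -{1}(fineK ftail) -EFinD -EFinM => -[].
(* Solving for [pi i] reduces the claim to a field identity with the nonzero denominator [ET]. *)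
have -> : pi i = (1 - p * Gamma Pr X P pi i n) / ET.
  by rewrite {1}total addrK mulfK// gt_eqF.
field.
by rewrite gt_eqF.
Qed.
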